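(* Let $\mathcal{P}^{(1)}$ and $\mathcal{P}^{(2)}$ be PTRSs with $\Sigma_D^{\mathcal{P}^{(1)}}\cap\Sigma_D^{\mathcal{P}^{(2)}}=\emptyset$. Then $\mathtt{AST}(\xrightarrow{\mathbf{i}}_{\mathcal{P}^{(1)}\cup\mathcal{P}^{(2)}})$ holds if and only if both $\mathtt{AST}(\xrightarrow{\mathbf{i}}_{\mathcal{P}^{(1)}})$ and $\mathtt{AST}(\xrightarrow{\mathbf{i}}_{\mathcal{P}^{(2)}})$ hold.
   Context: For a PTRS $\mathcal{P}$, $\Sigma^{\mathcal{P}}$ is the set of function symbols occurring in its rules, $\Sigma_D^{\mathcal{P}}\subseteq\Sigma^{\mathcal{P}}$ the defined symbols (root symbols of left-hand sides), and the remaining symbols are constructors (the two PTRSs may share constructors); $\mathcal{P}$ is considered on terms over $\Sigma^{\mathcal{P}}$ and countable variables. $\mathrm{FDist}(A)$: finite multisets of pairs $(p:a)$, $0<p\le1$, probabilities summing to 1. A PTRS is a countable set of rules $\ell\to\mu$, $\ell$ non-variable, $\mu$ a finite multi-distribution on terms, variables of terms in $\mu$ among those of $\ell$. $t\xrightarrow{\mathbf{i}}_{\mathcal{P}}\{p_1:t_1,\dots,p_k:t_k\}$ iff $t|_\pi=\ell\sigma$, $t_j=t[r_j\sigma]_\pi$ for a position $\pi$, rule $\ell\to\{p_1:r_1,\dots,p_k:r_k\}\in\mathcal{P}$, substitution $\sigma$, with all proper subterms of $\ell\sigma$ normal forms. Lifting $\rightrightarrows$ of $\to$: smallest relation on multi-distributions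 with $\{1:t\}\rightrightarrows\{1:t\}$ for normal forms, $\{1:t\}\rightrightarrows\mu$ if $t\to\mu$, closed under $\bigcup_jp_j\cdot\mu_j\rightrightarrows\bigcup_jp_j\cdot\nu_j$ ($\sum p_j=1$). $|\mu|_\to$: total probability of normal forms in $\mu$. $\mathtt{AST}(\to)$: every infinite $\rightrightarrows$-sequence $(\mu_n)$ satisfies $\lim_n|\mu_n|_\to=1$.
   Formalization: Besides disjoint defined symbols, the formal theorem assumes that every symbol occurring in both PTRSs is a constructor of both; without this the claim fails, e.g. for {a → {1:b}} and {b → {1:a}}. *)

(* Defs.v *)
From mathcomp Require Import all_boot all_order all_algebra.
From mathcomp Require Import all_classical all_reals all_analysis.
From Stdlib Require Import Permutation.
Set Implicit Arguments.
Unset Strict Implicit.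
Unset Printing Implicit Defensive.
Import Order.TTheory GRing.Theory Num.Theory.
Import numFieldNormedType.Exports.
Local Open Scope classical_set_scope.
Local Open Scope ring_scope.

(* First-order terms over the symbols [F] with arities [ar]; the countably     *)
(* many variables are the natural numbers.                                     *)
Inductive term (F : Type) (ar : F -> nat) : Type :=
| Var of nat
| App (f : F) of ('I_(ar f) -> term ar).

Arguments Var {F ar} _.
Arguments App {F ar} f _.

Fixpoint subst (F : Type) (ar : F -> nat) (sigma : nat -> term ar) (t : term ar)
    : term ar :=
  match t with
  | Var x => sigma x
  | App f ts => App f (fun j => subst sigma (ts j))
  end.

(* Positions are words over nat, with argument indices starting at 0.          *)
Fixpoint subterm_at (F : Type) (ar : F -> nat) (t : term ar) (pi : seq nat)
    : option (term ar) :=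
  match pi with
  | [::] => Some t
  | i :: pi' =>
    match t with
    | Var _ => None
    | App f ts => if insub i is Some j then subterm_at (ts j) pi' else None
    end
  end.

(* [replace_at t pi s] is t[s]_pi; it is only meaningful (and only used) when  *)
(* [pi] is a position of [t].                                                  *)
Fixpoint replace_at (F : Type) (ar : F -> nat) (t : term ar) (pi : seq nat)
    (s : term ar) : term ar :=
  match pi with
  | [::] => s
  | i :: pi' =>
    match t with
    | Var x => Var x
    | App f ts =>
      App f (fun j => if val j == i then replace_at (ts j) pi' s else ts j)
    end
  end.

Definition proper_subterm (F : Type) (ar : F -> nat) (s t : term ar) : Prop :=
  exists pi : seq nat, pi <> [::] /\ subterm_at t pi = Some s.

Fixpoint syms (F : Type) (ar : F -> nat) (t : term ar) : set F :=
  match t with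
  | Var _ => set0
  | App f ts => [set g | g = f \/ exists j, syms (ts j) g]
  end.

Fixpoint vars (F : Type) (ar : F -> nat) (t : term ar) : set nat :=
  match t with
  | Var x => [set x]
  | App f ts => [set y | exists j, vars (ts j) y]
  end.

(* A finite multiset of pairs (p : a) is represented by a list enumerating it. *)
(* Lists that are permutations of each other represent the same multiset; the  *)
(* constructor [lifting_perm] below makes the lifting insensitive to the       *)
(* choice of the enumeration.                                                  *)
Definition multidist (R : realType) (A : Type) : Type := seq (R * A).

Definition fdist (R : realType) (A : Type) (mu : multidist R A) : Prop :=
  (forall x, List.In x mu -> 0 < x.1 <= 1) /\ \sum_(x <- mu) x.1 = 1.

Definition supported_on (R : realType) (A : Type) (D : set A) (mu : multidist R A)
    : Prop :=
  forall x, List.In x mu -> D x.2.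

Definition mscale (R : realType) (A : Type) (p : R) (mu : multidist R A)
    : multidist R A :=
  [seq (p * x.1, x.2) | x <- mu].

(* The multiset union of the p_j . mu_j.                                       *)
Definition mconvex (R : realType) (A : Type) (n : nat) (p : 'I_n -> R)
    (mu : 'I_n -> multidist R A) : multidist R A :=
  flatten [seq mscale (p j) (mu j) | j <- enum 'I_n].

Definition normal_form (R : realType) (A : Type) (to : A -> multidist R A -> Prop)
    (a : A) : Prop :=
  ~ exists mu, to a mu.

Inductive lifting (R : realType) (A : Type) (to : A -> multidist R A -> Prop)
    : multidist R A -> multidist R A -> Prop :=
| lifting_nf a : normal_form to a -> lifting to [:: (1, a)] [:: (1, a)]
| lifting_step a mu : to a mu -> lifting to [:: (1, a)] mu
| lifting_convex (n : nat) (p : 'I_n -> R) (mu nu : 'I_n -> multidist R A) :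
    (forall j, 0 < p j) -> \sum_(j < n) p j = 1 ->
    (forall j, lifting to (mu j) (nu j)) ->
    lifting to (mconvex p mu) (mconvex p nu)
| lifting_perm mu mu' nu nu' :
    Permutation mu mu' -> Permutation nu nu' ->
    lifting to mu nu -> lifting to mu' nu'.

Definition nf_prob (R : realType) (A : Type) (to : A -> multidist R A -> Prop)
    (mu : multidist R A) : R :=
  \sum_(x <- mu | `[< normal_form to x.2 >]) x.1.

(* [D] is the set of objects on which the relation [to] is considered.         *)
Definition AST (R : realType) (A : Type) (D : set A)
    (to : A -> multidist R A -> Prop) : Prop :=
  forall mu : nat -> multidist R A,
    (forall n, fdist (mu n) /\ supported_on D (mu n)) ->
    (forall n, lifting to (mu n) (mu n.+1)) ->
    (fun n => nf_prob to (mu n)) @ \oo --> (1 : R).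

Record rule (R : realType) (F : Type) (ar : F -> nat) : Type := Rule {
  lhs : term ar;
  rhs : multidist R (term ar) }.

Definition is_PTRS (R : realType) (F : Type) (ar : F -> nat)
    (P : set (rule R ar)) : Prop :=
  countable P /\
  forall r, P r ->
    [/\ forall x, lhs r <> Var x,
        fdist (rhs r)
      & forall q, List.In q (rhs r) -> vars q.2 `<=` vars (lhs r)].

Definition signature (R : realType) (F : Type) (ar : F -> nat)
    (P : set (rule R ar)) : set F :=
  [set f | exists2 r, P r &
     syms (lhs r) f \/ exists2 q, List.In q (rhs r) & syms q.2 f].

Definition defined_symbols (R : realType) (F : Type) (ar : F -> nat)
    (P : set (rule R ar)) : set F :=
  [set f | exists2 r, P r & exists ts, lhs r = App f ts].

(* Two systems that may share constructors have only constructors (of both) in  *)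
(* common. Disjointness of the defined symbols alone would also allow a symbol  *)
(* defined in one system to be a constructor of the other, and modularity fails *)
(* there: a -> {1 : b} and b -> {1 : a}.                                        *)
Definition constructors (R : realType) (F : Type) (ar : F -> nat)
    (P : set (rule R ar)) : set F :=
  signature P `\` defined_symbols P.

Definition terms_over (F : Type) (ar : F -> nat) (S : set F) : set (term ar) :=
  [set t | syms t `<=` S].

Definition rewrite_step (R : realType) (F : Type) (ar : F -> nat)
    (P : set (rule R ar)) (t : term ar) (mu : multidist R (term ar)) : Prop :=
  exists (r : rule R ar) (sigma : nat -> term ar) (pi : seq nat),
    [/\ P r,
        subterm_at t pi = Some (subst sigma (lhs r))
      & mu = [seq (q.1, replace_at t pi (subst sigma q.2)) | q <- rhs r]].

Definition innermost_step (R : realType) (F : Type) (ar : F -> nat)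
    (P : set (rule R ar)) (t : term ar) (mu : multidist R (term ar)) : Prop :=
  exists (r : rule R ar) (sigma : nat -> term ar) (pi : seq nat),
    [/\ P r,
        subterm_at t pi = Some (subst sigma (lhs r)),
        mu = [seq (q.1, replace_at t pi (subst sigma q.2)) | q <- rhs r]
      & forall s, proper_subterm s (subst sigma (lhs r)) ->
          normal_form (rewrite_step P) s].

Definition innermost_AST (R : realType) (F : Type) (ar : F -> nat)
    (P : set (rule R ar)) : Prop :=
  AST (@terms_over F ar (signature P)) (innermost_step P).

(* Main.v *)
(* Almost-sure termination is characterised coinductively: it holds iff zero is *)
(* the only function [U] into [0, 1] with [U a <= sup (E_mu U)] over the steps   *)
(* [a -> mu] (evasive functions). Two facts give modularity. First, the          *)
(* interleaving of finitely many almost-surely terminating systems, under an     *)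
(* arbitrary scheduler, has no nonzero evasive function; as a root step of an    *)
(* innermost reduction needs normal arguments, structural induction on terms     *)
(* leaves only terms [f(t_1, ..., t_n)] with normal [t_i]. Second, if [f] is     *)
(* defined in [P1], replacing the maximal (normal) subterms whose root is foreign*)
(* to [P1] by variables turns the evaluation of such a term into an innermost    *)
(* evaluation of [P1] alone.                                                     *)

From HB Require Import structures.
Require Import Defs.
From mathcomp Require Import all_boot all_order all_algebra.
From mathcomp Require Import all_classical all_reals all_analysis.
From mathcomp Require Import lra.
From Stdlib Require Import Permutation.
Set Implicit Arguments.
Unset Strict Implicit.
Unset Printing Implicit Defensive.
Import Order.TTheory GRing.Theory Num.Theory.
Import numFieldNormedType.Exports.
Local Open Scope classical_set_scope.
Local Open Scope ring_scope.

(** * Expectations *)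

(** An evasive function never exceeds, up to an arbitrarily small slack, the best expected value
    reachable in one step. AST excludes nonzero evasive functions ([AST_evasion_free]), and their
    absence on all terms implies AST ([evasion_free_AST]). Statements about infinite runs thus
    become one-step inequalities, which combine well.

    For the union, every term is shown to be [doomed], by structural induction
    ([innermost_evasion_free]). The doomed arguments of a term reduce independently until a root
    step, which requires all of them to be normal; [interleaving_evasion_free] treats the
    independent phase. A call with normal arguments is treated by [innermost_call_doomed]: its
    maximal subterms with a foreign root are normal, hence inert, and replacing them by variables
    turns an evasive function of the union into one of a single component ([evasive_pullback]),
    which AST of that component forces to vanish.

    Conversely, on terms over its own signature a component has the same innermost steps as the
    union ([subsystem_innermost]), because shared symbols are constructors of both. *)

Definition expect (R : realType) (A : Type) (h : A -> R) (mu : multidist R A) : R :=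
  \sum_(x <- mu) x.1 * h x.2.

Lemma expect_cons (R : realType) (A : Type) (h : A -> R) x (mu : multidist R A) :
  expect h (x :: mu) = x.1 * h x.2 + expect h mu.
Proof. by rewrite /expect big_cons. Qed.

Lemma expect_dirac (R : realType) (A : Type) (h : A -> R) a :
  expect h [:: (1, a)] = h a.
Proof. by rewrite /expect big_seq1 mul1r. Qed.

Lemma expect_map (R : realType) (A B : Type) (g : A -> B) (h : B -> R)
    (mu : multidist R A) :
  expect h [seq (x.1, g x.2) | x <- mu] = expect (h \o g) mu.
Proof. by rewrite /expect big_map. Qed.

Lemma expect_mscale (R : realType) (A : Type) (h : A -> R) p (mu : multidist R A) :
  expect h (Defs.mscale p mu) = p * expect h mu.
Proof.
by rewrite /expect big_map mulr_sumr; apply: eq_bigr => x _ /=; rewrite mulrA.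
Qed.

Lemma expect_perm (R : realType) (A : Type) (h : A -> R) (mu nu : multidist R A) :
  Permutation mu nu -> expect h mu = expect h nu.
Proof.
elim=> [//|x l l' _ IH|x y l|l1 l2 l3 _ -> _ -> //]; rewrite !expect_cons.
- by rewrite IH.
- by rewrite addrCA.
Qed.

Lemma expect_mconvex (R : realType) (A : Type) (h : A -> R) n (p : 'I_n -> R)
    (mu : 'I_n -> multidist R A) :
  expect h (mconvex p mu) = \sum_(j < n) p j * expect h (mu j).
Proof.
rewrite {1}/expect /mconvex big_flatten big_map big_enum /=.
by apply: eq_bigr => j _; rewrite -expect_mscale.
Qed.

Lemma expectB (R : realType) (A : Type) (h k : A -> R) (mu : multidist R A) :
  expect (fun a => h a - k a) mu = expect h mu - expect k mu.
Proof. by rewrite /expect -sumrB; apply: eq_bigr => x _; rewrite mulrBr. Qed.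

Lemma expect_cst (R : realType) (A : Type) (c : R) (mu : multidist R A) :
  fdist mu -> expect (fun=> c) mu = c.
Proof. by case=> _ s1; rewrite /expect -mulr_suml s1 mul1r. Qed.

Lemma ler_expect (R : realType) (A : Type) (h k : A -> R) (mu : multidist R A) :
  fdist mu -> (forall x, List.In x mu -> h x.2 <= k x.2) ->
  expect h mu <= expect k mu.
Proof.
case=> + _; elim: mu => [|x mu IH] ps hk; first by rewrite /expect !big_nil.
rewrite !expect_cons lerD //.
  have /andP[/ltW x0 _] := ps x (or_introl erefl).
  by rewrite ler_wpM2l // hk //; left.
by apply: IH => y ymu; [apply: ps|apply: hk]; right.
Qed.

Lemma eq_expect (R : realType) (A : Type) (h k : A -> R) (mu : multidist R A) :
  (forall x, List.In x mu -> h x.2 = k x.2) -> expect h mu = expect k mu.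
Proof.
elim: mu => [|x mu IH] hk; first by rewrite /expect !big_nil.
by rewrite !expect_cons hk ?IH //; [move=> y ?; apply: hk; right|left].
Qed.

Lemma expect_ge0 (R : realType) (A : Type) (h : A -> R) (mu : multidist R A) :
  fdist mu -> (forall a, 0 <= h a) -> 0 <= expect h mu.
Proof.
by move=> fmu h0; rewrite -[leLHS](expect_cst 0 fmu); apply: ler_expect.
Qed.

Lemma expect_eq0 (R : realType) (A : Type) (h : A -> R) (mu : multidist R A) :
  fdist mu -> (forall a, 0 <= h a) -> expect h mu = 0 ->
  forall x, List.In x mu -> h x.2 = 0.
Proof.
case=> + _ h0; elim: mu => [//|x mu IH] ps.
have /andP[x0 _] := ps x (or_introl erefl).
have ps' y : List.In y mu -> 0 < y.1 <= 1 by move=> ymu; apply: ps; right.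
have mu0 : 0 <= expect h mu.
  elim: mu ps' {IH ps} => [|y mu IH] ps; first by rewrite /expect big_nil.
  have /andP[/ltW y0 _] := ps y (or_introl erefl).
  by rewrite expect_cons addr_ge0 ?mulr_ge0 // IH // => z zmu; apply: ps; right.
rewrite expect_cons => /eqP.
rewrite paddr_eq0 ?mulr_ge0 // ?(ltW x0) // mulf_eq0 gt_eqF //=.
by move=> /andP[/eqP hx /eqP hmu] y /= [<- //|]; apply: IH.
Qed.

(** * Sequential composition of multi-distributions *)

Definition mbind (R : realType) (A : Type) (mu : multidist R A)
    (k : A -> multidist R A) : multidist R A :=
  flatten [seq Defs.mscale x.1 (k x.2) | x <- mu].

Lemma expect_mbind (R : realType) (A : Type) (h : A -> R) (mu : multidist R A) k :
  expect h (mbind mu k) = expect (fun a => expect h (k a)) mu.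
Proof.
rewrite {1}/expect /mbind big_flatten big_map.
by apply: eq_bigr => x _; rewrite -expect_mscale.
Qed.

Lemma in_mbind (R : realType) (A : Type) (mu : multidist R A) k y :
  List.In y (mbind mu k) ->
  exists x z, [/\ List.In x mu, List.In z (k x.2) & y = (x.1 * z.1, z.2)].
Proof.
elim: mu => [//|x mu IH]; rewrite /mbind /= => /List.in_app_iff[|/IH].
  by move=> /List.in_map_iff[z [<- zk]]; exists x, z; split=> //; left.
by move=> [x' [z [? ? ?]]]; exists x', z; split=> //; right.
Qed.

Lemma fdist_mbind (R : realType) (A : Type) (mu : multidist R A) k :
  fdist mu -> (forall x, List.In x mu -> fdist (k x.2)) -> fdist (mbind mu k).
Proof.
move=> fmu fk; split=> [y|].
  move=> /in_mbind[x [z [xmu zk -> /=]]].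
  have /andP[x0 x1] := fmu.1 _ xmu; have /andP[z0 z1] := (fk _ xmu).1 _ zk.
  by rewrite mulr_gt0 //= mulr_ile1 // ltW.
have e1 (nu : multidist R A) : \sum_(x <- nu) x.1 = expect (fun=> 1) nu.
  by rewrite /expect; apply: eq_bigr => x _; rewrite mulr1.
rewrite e1 expect_mbind -[RHS](expect_cst 1 fmu).
by apply: eq_expect => x xmu; rewrite expect_cst //; apply: fk.
Qed.

Lemma tnth_In (A : Type) (s : seq A) (j : 'I_(size s)) :
  List.In (tnth (in_tuple s) j) s.
Proof.
case: j => i lt_i; rewrite (tnth_nth (tnth (in_tuple s) (Ordinal lt_i))) /=.
move: (tnth _ _) => x0; elim: s i lt_i => [//|x s IH] [|i] lt_i /=.
  by left.
by right; apply: IH.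
Qed.

(** [mu] is the convex combination of its Dirac distributions, so [lifting_convex] applies with one
    component per entry. *)
Lemma lifting_mbind (R : realType) (A : Type) (to : A -> multidist R A -> Prop)
    (mu : multidist R A) k :
  fdist mu -> (forall x, List.In x mu -> lifting to [:: (1, x.2)] (k x.2)) ->
  lifting to mu (mbind mu k).
Proof.
move=> [p0 p1] lk; pose t := in_tuple mu.
have tE : [seq tnth t j | j <- enum 'I_(size mu)] = mu by apply: map_tnth_enum.
have -> : mbind mu k = mconvex (fun j => (tnth t j).1) (fun j => k (tnth t j).2).
  by rewrite /mbind /mconvex -[in LHS]tE -map_comp.
have -> : lifting to mu = lifting to
    (mconvex (fun j => (tnth t j).1) (fun j => [:: (1, (tnth t j).2)])).
  congr lifting; rewrite /mconvex -[in LHS]tE.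
  elim: (enum _) => //= j s <-.
  by rewrite mulr1; case: (tnth t j).
apply: lifting_convex => [j||j].
- by have /andP[] := p0 _ (@tnth_In _ mu j).
- by rewrite -p1 -[in RHS]tE big_map big_enum.
- exact: lk (@tnth_In _ mu j).
Qed.

(** * Evasive functions *)

(* A function bounded by the probability that some strategy avoids normal forms *)
(* forever; the slack [e] stands for the supremum over the possible steps.      *)
Definition evasive (R : realType) (A : Type) (D : set A)
    (to : A -> multidist R A -> Prop) (U : A -> R) : Prop :=
  (forall a, 0 <= U a <= 1) /\
  forall a, D a -> 0 < U a -> forall e, 0 < e ->
    exists2 mu, to a mu & U a <= expect U mu + e.

Definition evasion_free (R : realType) (A : Type) (D : set A)
    (to : A -> multidist R A -> Prop) : Prop :=
  forall U, evasive D to U -> forall a, D a -> U a = 0.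

Definition stochastic (R : realType) (A : Type) (to : A -> multidist R A -> Prop)
    : Prop :=
  forall a mu, to a mu -> fdist mu.

Definition step_closed (R : realType) (A : Type) (D : set A)
    (to : A -> multidist R A -> Prop) : Prop :=
  forall a mu, D a -> to a mu -> supported_on D mu.

Lemma nf_probE (R : realType) (A : Type) (to : A -> multidist R A -> Prop)
    (mu : multidist R A) :
  fdist mu ->
  nf_prob to mu = 1 - expect (fun a => (`[< ~ normal_form to a >])%:R) mu.
Proof.
move=> fmu; rewrite -[X in X - _](expect_cst 1 fmu) -expectB /nf_prob big_mkcond.
rewrite /expect; apply: eq_bigr => x _; rewrite asbool_neg.
by case: `[< _ >]; rewrite /= ?subr0 ?subrr ?mulr1 ?mulr0.
Qed.

(** From [a0], follow steps that lose at most [u / 2 ^+ n.+2] of the expected [U] in round [n]. The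
    total loss is at most [u / 2], so the expectation of [U] never drops below [u / 2]. As [U]
    vanishes at normal forms in [D], the mass outside normal forms stays at least [u / 2], against
    AST. *)
Lemma AST_evasion_free (R : realType) (A : Type) (D : set A)
    (to : A -> multidist R A -> Prop) :
  stochastic to -> step_closed D to -> AST D to -> evasion_free D to.
Proof.
move=> sto cl ast U [U01 Uto] a0 Da0; apply/eqP; apply: contraT => Ua0.
have U0 a : 0 <= U a by have /andP[] := U01 a.
have U1 a : U a <= 1 by have /andP[] := U01 a.
have u0 : 0 < U a0 by rewrite lt_neqAle eq_sym Ua0 U0.
set u := U a0 in u0.
have /choice[st stP] (na : nat * A) : exists nu : multidist R A, D na.2 ->
    [/\ fdist nu, supported_on D nu, lifting to [:: (1, na.2)] nu
      & U na.2 <= expect U nu + u / 2 ^+ na.1.+2].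
  case: na => n a /=.
  have e0 : 0 < u / 2 ^+ n.+2 by rewrite divr_gt0 // exprn_gt0.
  have [Da|nDa] := pselect (D a); last by exists [::].
  have [nf|/contrapT[nu tonu]] := pselect (normal_form to a).
    exists [:: (1, a)] => _; split.
    - by split=> [x [<-|//] /=|]; rewrite ?big_seq1 // ltr01 lexx.
    - by move=> x [<-|].
    - exact: lifting_nf.
    - by rewrite expect_dirac lerDl ltW.
  have [Ua|Ua] := ltP 0 (U a).
    have [nu' tonu' Unu'] := Uto a Da Ua _ e0.
    by exists nu' => _; split=> //; [exact: sto tonu'|exact: cl tonu'|exact: lifting_step].
  exists nu => _; split=> //; [exact: sto tonu|exact: cl tonu|exact: lifting_step|].
  rewrite (le_trans Ua) // addr_ge0 ?(ltW e0) // expect_ge0 //; exact: sto tonu.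
pose mu := fix mu n := if n is m.+1 then mbind (mu m) (fun a => st (m, a))
                       else [:: (1, a0)].
have muP n : fdist (mu n) /\ supported_on D (mu n).
  elim: n => [|n [fn sn]] /=.
    split; last by move=> x [<-|].
    by split=> [x [<-|//] /=|]; rewrite ?big_seq1 // ltr01 lexx.
  split; first by apply: fdist_mbind => // x /sn /(stP (n, x.2))[].
  move=> y /in_mbind[x [z [/sn Dx zk -> /=]]].
  by have [_ + _ _] := stP (n, x.2) Dx; apply.
have mul n : lifting to (mu n) (mu n.+1).
  have [fn sn] := muP n; apply: lifting_mbind => // x /sn Dx.
  by have [] := stP (n, x.2) Dx.
(* The margin [u / 2 ^+ n.+1] is the sum of the losses still to come. *)
have muU n : u / 2 + u / 2 ^+ n.+1 <= expect U (mu n).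
  elim: n => [|n IH]; first by rewrite expect_dirac expr1 -splitr.
  have [fn sn] := muP n.
  rewrite expect_mbind.
  have : expect U (mu n) - u / 2 ^+ n.+2 <=
         expect (fun a => expect U (st (n, a))) (mu n).
    rewrite -[X in _ - X <= _](expect_cst _ fn) -expectB.
    apply: ler_expect => // x /sn Dx; rewrite lerBlDr.
    by have [] := stP (n, x.2) Dx.
  apply: le_trans; rewrite lerBrDr; apply: le_trans IH.
  rewrite -addrA lerD2l [2 ^+ n.+2]exprS invfM; set v := (_ ^+ _)^-1; lra.
have := ast mu muP mul.
move=> /cvgrPdist_lt /(_ (u / 2)); case; first by rewrite divr_gt0.
move=> N _ /(_ N (leqnn N)) /=; have [fN _] := muP N.
rewrite nf_probE // opprB addrC subrK; apply: contraTT => _; rewrite -leNgt.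
apply: le_trans (ler_norm _).
have : expect U (mu N) <= expect (fun a => (`[< ~ normal_form to a >])%:R) (mu N).
  apply: ler_expect => // x xmu; case: asboolP => [_ //|/contrapT nf].
  rewrite leNgt; apply/negP => Ux; have [] := muP N => _ /(_ _ xmu) Dx.
  by have [nu tonu _] := Uto _ Dx Ux 1 ltr01; apply: nf; exists nu.
apply: le_trans; apply: le_trans (muU N).
by rewrite lerDl divr_ge0 ?(ltW u0) // exprn_ge0.
Qed.

(** * From a run that keeps avoiding normal forms to an evasive function *)

Lemma lifting_expect (R : realType) (A : Type) (to : A -> multidist R A -> Prop)
    (h k : A -> R) (mu nu : multidist R A) :
  (forall a, normal_form to a -> h a <= k a) ->
  (forall a mu, to a mu -> expect h mu <= k a) ->
  lifting to mu nu -> expect h nu <= expect k mu.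
Proof.
move=> hnf hto; elim=> [a nf|a {}mu tomu|n p {}mu {}nu p0 _ _ IH|
                        {}mu mu' {}nu nu' /expect_perm <- /expect_perm <- //].
- by rewrite !expect_dirac hnf.
- by rewrite expect_dirac hto.
- by rewrite !expect_mconvex ler_sum // => j _; rewrite ler_wpM2l // ltW.
Qed.

(** The Bellman operator of the maximisation problem; the added 0 is its value at normal forms. *)
Definition best_step (R : realType) (A : Type) (to : A -> multidist R A -> Prop)
    (h : A -> R) (a : A) : R :=
  sup (0 |` [set expect h mu | mu in [set mu | to a mu]]).

Section BestStep.
Context (R : realType) (A : Type) (to : A -> multidist R A -> Prop) (h : A -> R).
Hypotheses (sto : stochastic to) (h01 : forall a, 0 <= h a <= 1).

Let has_sup_best a : has_sup (0 |` [set expect h mu | mu in [set mu | to a mu]]).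
Proof.
split; first by exists 0; left.
exists 1 => _ [->//|[mu tomu <-]]; have fmu := sto tomu.
by rewrite -[leRHS](expect_cst 1 fmu) ler_expect // => x _; have /andP[] := h01 x.2.
Qed.

Lemma best_step_ge0 a : 0 <= best_step to h a.
Proof. by apply: sup_upper_bound; [exact: has_sup_best|left]. Qed.

Lemma best_step_ge a mu : to a mu -> expect h mu <= best_step to h a.
Proof.
by move=> tomu; apply: sup_upper_bound; [exact: has_sup_best|right; exists mu].
Qed.

Lemma best_step_le a c :
  0 <= c -> (forall mu, to a mu -> expect h mu <= c) -> best_step to h a <= c.
Proof.
by move=> c0 hc; apply: ge_sup; [exists 0; left|move=> _ [->//|[mu /hc + <-]]].
Qed.

Lemma best_step_approx a e : 0 < best_step to h a -> 0 < e ->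
  exists2 mu, to a mu & best_step to h a <= expect h mu + e.
Proof.
(* A slack of at most half the supremum keeps the approximating value away from the added 0. *)
move=> b0 e0; pose d := Num.min e (best_step to h a / 2).
have d0 : 0 < d by rewrite lt_min e0 divr_gt0.
have de : d <= e by rewrite ge_min lexx.
have db : d <= best_step to h a / 2 by rewrite ge_min lexx orbT.
have [_ [->|[mu tomu <-]]] := sup_adherent d0 (has_sup_best a).
  by rewrite -/(best_step to h a) => ?; exfalso; lra.
by rewrite -/(best_step to h a) => ?; exists mu => //; lra.
Qed.
End BestStep.

(** Of two comparable members the smaller serves both points, so one member of a chain is near the
    infimum on a whole finite support. This lets expectations pass to the infimum of a chain. *)
Lemma chain_inf_approx (R : realType) (A : Type) (C : set (A -> R)) :
  C !=set0 -> (forall h a, C h -> 0 <= h a) ->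
  (forall h k, C h -> C k -> (forall a, h a <= k a) \/ (forall a, k a <= h a)) ->
  forall (s : seq A) e, 0 < e ->
  exists2 h, C h & forall a, List.In a s -> h a <= inf [set k a | k in C] + e.
Proof.
move=> [h0 Ch0] C0 Ctot s e e0; elim: s => [|a s [h Ch hs]]; first by exists h0.
have hinf : has_inf [set k a | k in C].
  by split; [exists (h0 a), h0|exists 0 => _ [k Ck <-]; apply: C0].
have [_ [k Ck <-] /ltW ka] := inf_adherent e0 hinf.
case: (Ctot h k Ch Ck) => hk.
  exists h => // b /= [<-|/hs//]; exact: le_trans (hk a) ka.
by exists k => // b /= [<- //|/hs]; apply: le_trans.
Qed.

(* Zorn's lemma replaces the transfinite iteration of [best_step]: the chain of *)
(* its iterates need not stabilise after omega steps, because a term may have   *)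
(* infinitely many reducts.                                                     *)
Lemma evasive_limit (R : realType) (A : Type) (to : A -> multidist R A -> Prop)
    (mu : nat -> multidist R A) (c : R) :
  stochastic to -> (forall n, fdist (mu n)) ->
  (forall n, lifting to (mu n) (mu n.+1)) ->
  (forall n, c <= expect (fun a => (`[< ~ normal_form to a >])%:R) (mu n)) ->
  exists2 h, evasive setT to h & c <= expect h (mu 0%N).
Proof.
move=> sto fmu mul cmu; pose h0 a : R := (`[< ~ normal_form to a >])%:R.
(* Functions that no step increases in expectation and whose expectation stays at least [c] along
   the run; [h0] is one of them. *)
pose F (h : A -> R) := [/\ forall a, 0 <= h a <= 1,
  forall a nu, to a nu -> expect h nu <= h a,
  forall a, normal_form to a -> h a = 0
  & forall n, c <= expect h (mu n)].
have Fh0 : F h0.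
  have h01 a : 0 <= h0 a <= 1 by rewrite /h0; case: `[< _ >]; rewrite /= ?lexx ler01.
  split=> // [a nu tonu|a nf]; last by rewrite /h0; case: asboolP.
  have -> : h0 a = 1 by rewrite /h0; case: asboolP => // /contrapT[]; exists nu.
  have fnu := sto _ _ tonu; rewrite -[leRHS](expect_cst 1 fnu) ler_expect // => x _.
  by have /andP[] := h01 x.2.
(* The order is reversed, so Zorn's lemma yields a pointwise minimal function. *)
pose rl (h k : {h | F h}) := `[< forall a, sval k a <= sval h a >].
have [|||C Ctot|[h Fh] hmin] := @Zorn _ rl.
- by move=> h; apply/asboolP.
- move=> h k l /asboolP hk /asboolP kl; apply/asboolP => a.
  exact: le_trans (kl a) (hk a).
- move=> [h Fh] [k Fk] /asboolP /= hk /asboolP /= kh; apply: eq_exist => /=.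
  by apply/funext => a; apply/le_anti; rewrite hk kh.
- have [C0|/set0P[k0 Ck0]] := eqVneq C set0.
    by exists (exist _ _ Fh0) => s; rewrite C0.
  pose C' := [set sval k | k in C].
  have C'F h : C' h -> F h by case=> [[k Fk] _ <-].
  have C'tot h k : C' h -> C' k -> (forall a, h a <= k a) \/ (forall a, k a <= h a).
    move=> [x Cx <-] [y Cy <-].
    by case: (Ctot x y Cx Cy) => /asboolP; [right|left].
  have C'0 h a : C' h -> 0 <= h a by move=> /C'F[/(_ a)/andP[]].
  have C'ne : C' !=set0 by exists (sval k0), k0.
  pose g a := inf [set k a | k in C'].
  have gle k a : C' k -> g a <= k a.
    by move=> Ck; apply: ge_inf; [exists 0 => _ [l /C'0 + <-]; apply|exists k].
  have gge a x : (forall k, C' k -> x <= k a) -> x <= g a.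
    move=> xk; apply: lb_le_inf; first by have [k Ck] := C'ne; exists (k a), k.
    by move=> _ [k /xk + <-].
  have Fg : F g.
    have [k Ck] := C'ne; have [k01 _ knf _] := C'F _ Ck; split.
    + move=> a; rewrite gge /=; last by move=> l /C'0.
      by rewrite (le_trans (gle _ _ Ck)) //; have /andP[] := k01 a.
    + move=> a nu tonu; apply: gge => l Cl; have [_ lto _ _] := C'F _ Cl.
      apply: le_trans (lto _ _ tonu); apply: ler_expect; first exact: sto tonu.
      by move=> x _; apply: gle.
    + move=> a nf; apply/le_anti; rewrite -{1}(knf a nf) gle //=.
      by apply: gge => l /C'0.
    + move=> n; apply/ler_addgt0Pr => e e0.
      have [l Cl lg] := chain_inf_approx C'ne C'0 C'tot [seq x.2 | x <- mu n] e0.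
      have [_ _ _ cl] := C'F _ Cl; apply: le_trans (cl n) _.
      rewrite -lerBlDl -expectB -[leRHS](expect_cst e (fmu n)).
      by apply: ler_expect => // x xmu; rewrite lerBlDl lg //; apply: List.in_map.
  exists (exist _ _ Fg) => s Cs; apply/asboolP => a /=.
  by apply: gle; exists s.
(* [best_step to h] lies below [h] and is again in [F], so minimality makes [h] a fixed point, hence
   evasive. *)
have [h01 hto hnf ch] := Fh; pose k := best_step to h.
have kh a : k a <= h a.
  by apply: best_step_le => [|nu /hto//]; have /andP[] := h01 a.
have k0 a : 0 <= k a by apply: best_step_ge0.
have Fk : F k.
  split=> [a|a nu tonu|a nf|n].
  - by rewrite k0 (le_trans (kh a)) //; have /andP[] := h01 a.
  - apply: le_trans (best_step_ge sto h01 tonu); apply: ler_expect => //.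
    exact: sto tonu.
  - by apply/le_anti; rewrite k0 -{1}(hnf a nf) kh.
  (* The bound for [k] at time [n] comes from that for [h] at time [n.+1], which is why [F] asks for
     it at all times. *)
  - apply: le_trans (ch n.+1) _; apply: lifting_expect (mul n) => [a nf|a nu].
      by rewrite hnf.
    exact: best_step_ge.
have rk : rl (exist _ h Fh) (exist _ k Fk) by apply/asboolP.
have kE : k = h by have /(congr1 (fun x : {h | F h} => sval x)) := hmin _ rk.
exists h => //; split=> // a _; rewrite -kE => ka e e0.
have [nu tonu le] := best_step_approx sto h01 ka e0.
by exists nu => //; rewrite [in leRHS]kE.
Qed.

(** The mass outside normal forms decreases along a run. Either it tends to 0, or it stays above
    some [e], and then [evasive_limit] yields an evasive function with positive expectation at the
    start. *)
Lemma evasion_free_AST (R : realType) (A : Type) (D : set A)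
    (to : A -> multidist R A -> Prop) :
  stochastic to -> evasion_free setT to -> AST D to.
Proof.
move=> sto ef mu mufd mul; have fmu n : fdist (mu n) by have [] := mufd n.
pose h0 a : R := (`[< ~ normal_form to a >])%:R.
have h00 a : 0 <= h0 a by rewrite ler0n.
have step n : expect h0 (mu n.+1) <= expect h0 (mu n).
  apply: lifting_expect (mul n) => // a nu tonu.
  have -> : h0 a = 1 by rewrite /h0; case: asboolP => // /contrapT[]; exists nu.
  have fnu := sto _ _ tonu; rewrite -[leRHS](expect_cst 1 fnu) ler_expect // => x _.
  by rewrite /h0; case: `[< _ >].
have mono m n : (m <= n)%N -> expect h0 (mu n) <= expect h0 (mu m).
  move=> /subnK <-; elim: (n - m)%N => [//|k IH]; exact: le_trans (step _) IH.
apply/cvgrPdist_lt => e e0.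
have [[N NP]|nex] := pselect (exists N, expect h0 (mu N) < e).
  exists N => // n /= Nn; rewrite nf_probE // opprB addrC subrK ger0_norm.
    exact: le_lt_trans (mono _ _ Nn) NP.
  exact: expect_ge0.
have en n : e <= expect h0 (mu n).
  by rewrite leNgt; apply/negP => ?; apply: nex; exists n.
have [h hev eh] := evasive_limit sto fmu mul en.
have := le_trans eh; rewrite (_ : expect h (mu 0%N) = 0) => [/(_ _ (lexx _))|].
  by rewrite leNgt e0.
rewrite -(expect_cst 0 (fmu 0%N)); apply: eq_expect => x _; exact: ef.
Qed.

(** * Interleaving of the components of a tuple *)

Definition upd (A : Type) (n : nat) (ts : 'I_n -> A) (j : 'I_n) (b : A) : 'I_n -> A :=
  fun i => if i == j then b else ts i.

Lemma upd_same (A : Type) (n : nat) (ts : 'I_n -> A) j b : upd ts j b j = b.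
Proof. by rewrite /upd eqxx. Qed.

Lemma upd_id (A : Type) (n : nat) (ts : 'I_n -> A) j : upd ts j (ts j) = ts.
Proof. by apply/funext => i; rewrite /upd; case: eqP => // ->. Qed.

Lemma updK (A : Type) (n : nat) (ts : 'I_n -> A) j a b :
  upd (upd ts j a) j b = upd ts j b.
Proof. by apply/funext => i; rewrite /upd; case: eqP. Qed.

Lemma updC (A : Type) (n : nat) (ts : 'I_n -> A) i j a b : i != j ->
  upd (upd ts i a) j b = upd (upd ts j b) i a.
Proof.
move=> ij; apply/funext => l; rewrite /upd.
by case: eqP => [->|//]; rewrite eq_sym (negbTE ij).
Qed.

Lemma upd_in (A : Type) (D : set A) (n : nat) (ts : 'I_n -> A) j b :
  (forall i, D (ts i)) -> D b -> forall i, D (upd ts j b i).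
Proof. by move=> Dts Db i; rewrite /upd; case: eqP. Qed.

(* Interleaving of evasion-free components, of which only the first [k] move.   *)
(* With [W a] the best value when component [k] is frozen at [a], a strategy    *)
(* that postpones component [k] cannot do better than the best step of [a],     *)
(* since the remaining components are evasion-free.                             *)
Lemma interleaving_evasion_free (R : realType) (A : Type) (D : set A)
    (to : A -> multidist R A -> Prop) (n k : nat) (V : ('I_n -> A) -> R) :
  stochastic to -> step_closed D to -> evasion_free D to ->
  (forall ts, 0 <= V ts <= 1) ->
  (forall ts, (forall j, D (ts j)) -> 0 < V ts -> forall e : R, 0 < e ->
    exists (j : 'I_n) mu, [/\ (j < k)%N, to (ts j) mu
      & V ts <= expect (fun b => V (upd ts j b)) mu + e]) ->
  forall ts, (forall j, D (ts j)) -> V ts = 0.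
Proof.
move=> sto cl ef; elim: k V => [|k IH] V V01 Vto ts Dts.
  have [V0 _] := andP (V01 ts); apply/eqP; rewrite eq_le V0 leNgt andbT.
  by apply/negP => /(Vto _ Dts) /(_ 1 ltr01) [j [mu []]].
have [nk|kn] := leqP n k.
  apply: IH => // us Dus Vus e e0.
  have [j [mu [_ ? ?]]] := Vto us Dus Vus e e0.
  by exists j, mu; split=> //; exact: leq_trans (ltn_ord j) nk.
pose K := Ordinal kn.
pose S a := [set V us | us in [set us | (forall j, D (us j)) /\ us K = a]].
pose W a := sup (S a).
have Sub a : has_ubound (S a).
  by exists 1 => _ [us _ <-]; have /andP[] := V01 us.
have VW us : (forall j, D (us j)) -> V us <= W (us K).
  by move=> Dus; apply: ub_le_sup => //; exists us.
have W01 a : 0 <= W a <= 1.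
  rewrite /W; have [->|/set0P[x Sx]] := eqVneq (S a) set0.
    by rewrite sup0 lexx ler01.
  rewrite ge_sup; [|by exists x|by move=> _ [us _ <-]; have /andP[] := V01 us].
  rewrite andbT; apply: le_trans (ub_le_sup (Sub a) Sx).
  by have [us _ <-] := Sx; have /andP[] := V01 us.
suff Wev : evasive D to W.
  have [V0 _] := andP (V01 ts); apply/le_anti; rewrite V0 andbT.
  by rewrite -(ef W Wev (ts K) (Dts K)) VW.
split=> // a Da Wa e e0; apply: contrapT => nex.
(* If [W] is not evasive at [a], every step of [a] brings its expectation down to [g < W a]. *)
pose g := Num.max 0 (W a - e).
have g0 : 0 <= g by rewrite le_max lexx.
have gW : g < W a by rewrite gt_max Wa ltrBlDr ltrDl.
have gmu mu : to a mu -> expect W mu <= g.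
  move=> tomu; rewrite le_max; apply/orP; right; rewrite leNgt; apply/negP => lt.
  by apply: nex; exists mu => //; rewrite -lerBlDr ltW.
(* The excess over [g] with component [K] frozen at [a]. Moving [K] cannot realise an excess, so
   [phi] is driven by the first [k] components and the induction hypothesis applies. *)
pose phi us := Num.max 0 (V (upd us K a) - g).
suff phi0 us : (forall j, D (us j)) -> phi us = 0.
  suff : W a <= g by rewrite leNgt gW.
  apply: ge_sup.
    apply/set0P/eqP => S0; move: Wa; rewrite /W S0 sup0 ltxx //.
  move=> _ [us [Dus usa] <-]; have := phi0 us Dus.
  by rewrite /phi -usa upd_id => /eqP; rewrite eq_maxl subr_le0.
move: us; apply: IH => [us|us Dus].
  rewrite /phi le_max lexx /= ge_max ler01 /= lerBlDr.
  by have /andP[_ /le_trans->] := V01 (upd us K a); rewrite // lerDl.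
rewrite /phi lt_max ltxx /= subr_gt0 => gV d d0.
have Dua : forall j, D (upd us K a j) by apply: upd_in.
(* Half the excess as slack: a near-optimal step of [K] would still have expectation above [g]. *)
pose d' := Num.min d ((V (upd us K a) - g) / 2).
have d'0 : 0 < d' by rewrite lt_min d0 divr_gt0 // subr_gt0.
have d'd : d' <= d by rewrite ge_min lexx.
have d'V : d' <= (V (upd us K a) - g) / 2 by rewrite ge_min lexx orbT.
have [j [mu [jk tomu Vmu]]] := Vto _ Dua (le_lt_trans g0 gV) _ d'0.
have [jK|jK] := eqVneq j K.
  exfalso; move: tomu Vmu; rewrite jK upd_same => tomu.
  have : expect (fun b => V (upd (upd us K a) K b)) mu <= expect W mu.
    apply: ler_expect; [exact: sto tomu|move=> x xmu].
    have Dx := cl _ _ Da tomu _ xmu; rewrite updK.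
    by have := VW (upd us K x.2) (upd_in K Dus Dx); rewrite upd_same.
  have := gmu _ tomu; lra.
have usj : upd us K a j = us j by rewrite /upd (negbTE jK).
rewrite usj in tomu; exists j, mu; split=> //.
  by rewrite ltn_neqAle -ltnS jk andbT; apply: contra jK => /eqP jk'; apply/eqP/val_inj.
have fmu := sto _ _ tomu.
have : expect (fun b => V (upd (upd us K a) j b)) mu - g <=
       expect (fun b => phi (upd us j b)) mu.
  rewrite -[X in _ - X <= _](expect_cst g fmu) -expectB; apply: ler_expect => // x _.
  by rewrite /phi updC ?le_max ?lexx ?orbT // eq_sym.
rewrite (max_idPr _) ?subr_ge0 ?(ltW gV) //; lra.
Qed.

(** * Points at which every evasive function vanishes *)

Definition doomed (R : realType) (A : Type) (to : A -> multidist R A -> Prop)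
    : set A :=
  [set a | forall U, evasive setT to U -> U a = 0].

(** Raising [U] at [a] to [expect U mu] keeps it evasive, the step to [mu] being the witness. Hence
    this expectation is 0, and so is [U] on the support of [mu]. *)
Lemma doomed_step_closed (R : realType) (A : Type)
    (to : A -> multidist R A -> Prop) :
  stochastic to -> step_closed (doomed to) to.
Proof.
move=> sto a mu Ta tomu x xmu U [U01 Uto].
have fmu := sto _ _ tomu; have Ua : U a = 0 by apply: Ta.
have U0 b : 0 <= U b by have /andP[] := U01 b.
pose U' b := if `[< b = a >] then expect U mu else U b.
have E0 : 0 <= expect U mu by apply: expect_ge0.
have UU' b : U b <= U' b by rewrite /U'; case: asboolP => [->|//]; rewrite Ua.
suff evU' : evasive setT to U'.
  have := Ta U' evU'; rewrite /U'; case: asboolP => // _.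
  by move=> /(expect_eq0 fmu U0); apply.
split=> [b|b _].
  rewrite /U'; case: asboolP => // _; rewrite E0 -[leRHS](expect_cst 1 fmu).
  by apply: ler_expect => // y _; have /andP[] := U01 y.2.
rewrite [X in 0 < X -> _]/U'; case: asboolP => [->|nba] /= Ub e e0.
  exists mu => //; rewrite {1}/U'; case: asboolP => // _.
  rewrite (@le_trans _ _ (expect U' mu)) ?lerDl ?(ltW e0) //.
  by apply: ler_expect.
have [nu tonu Unu] := Uto b I Ub e e0; exists nu => //.
rewrite {1}/U'; case: asboolP => // _; apply: (le_trans Unu).
by rewrite lerD2r; apply: ler_expect => //; exact: sto tonu.
Qed.

(** Step-closure allows an evasive function on the doomed points to be extended by 0 to all
    points. *)
Lemma doomed_evasion_free (R : realType) (A : Type)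
    (to : A -> multidist R A -> Prop) :
  stochastic to -> evasion_free (doomed to) to.
Proof.
move=> sto U [U01 Uto] a Ta.
pose U' b := if `[< doomed to b >] then U b else 0.
have U'E b : doomed to b -> U' b = U b by rewrite /U'; case: asboolP.
rewrite -U'E //; apply: Ta; split=> [b|b _].
  by rewrite /U'; case: asboolP => // _; rewrite lexx ler01.
rewrite {1}/U'; case: asboolP => [Tb Ub e e0|]; last by rewrite ltxx.
have [nu tonu Unu] := Uto b Tb Ub e e0; exists nu => //.
rewrite U'E // (@eq_expect _ _ U' U) // => x xnu.
exact: U'E (doomed_step_closed sto Tb tonu xnu).
Qed.

(** * Terms *)

Lemma App_inj (F : Type) (ar : F -> nat) f (ts us : 'I_(ar f) -> term ar) :
  App f ts = App f us -> ts = us.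
Proof.
by case; apply: Eqdep_dec.inj_pair2_eq_dec => x y; exact: pselect.
Qed.

Lemma eq_subst (F : Type) (ar : F -> nat) (sigma tau : nat -> term ar) t :
  (forall x, vars t x -> sigma x = tau x) -> subst sigma t = subst tau t.
Proof.
elim: t => [x|f ts IH] /= st; first exact: st.
by congr App; apply/funext => j; apply: IH => x xj; apply: st; exists j.
Qed.

Lemma subst_subst (F : Type) (ar : F -> nat) (sigma tau : nat -> term ar) t :
  subst tau (subst sigma t) = subst (fun x => subst tau (sigma x)) t.
Proof. by elim: t => [//|f ts IH] /=; congr App; apply/funext. Qed.

Lemma syms_subst (F : Type) (ar : F -> nat) (sigma : nat -> term ar) t f :
  syms (subst sigma t) f -> syms t f \/ exists2 x, vars t x & syms (sigma x) f.
Proof.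
elim: t => [x|g ts IH] /=; first by right; exists x.
move=> [->|[j /IH[fj|[x xj fx]]]]; first by left; left.
- by left; right; exists j.
- by right; exists x => //; exists j.
Qed.

Lemma syms_subst_var (F : Type) (ar : F -> nat) (sigma : nat -> term ar) t x :
  vars t x -> syms (sigma x) `<=` syms (subst sigma t).
Proof.
elim: t => [y /= <- //|g ts IH] /= [j xj] f fx; right; exists j.
exact: IH fx.
Qed.

Lemma subterm_nil (F : Type) (ar : F -> nat) (t : term ar) :
  subterm_at t [::] = Some t.
Proof. by case: t. Qed.

Lemma replace_nil (F : Type) (ar : F -> nat) (t s : term ar) :
  replace_at t [::] s = s.
Proof. by case: t. Qed.

Lemma syms_subterm (F : Type) (ar : F -> nat) (t u : term ar) pi :
  subterm_at t pi = Some u -> syms u `<=` syms t.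
Proof.
elim: pi t => [t|i pi IH [//|f ts]] /=; first by rewrite subterm_nil => -[->].
by case: insubP => // j _ _ /IH su g /su ?; right; exists j.
Qed.

Lemma syms_replace (F : Type) (ar : F -> nat) (t s : term ar) pi :
  syms (replace_at t pi s) `<=` syms t `|` syms s.
Proof.
elim: pi t => [t f|i pi IH [x f|f ts g]] /=; [by rewrite replace_nil; right|by left|].
move=> [->|[j]]; first by left; left.
case: ifP => _; last by left; right; exists j.
by move=> /IH[|]; [left; right; exists j|right].
Qed.

Lemma subterm_cat (F : Type) (ar : F -> nat) (t u : term ar) pi pi' :
  subterm_at t pi = Some u -> subterm_at t (pi ++ pi') = subterm_at u pi'.
Proof.
elim: pi t => [t|i pi IH [//|f ts]] /=; first by rewrite subterm_nil => -[->].
by case: insubP => // j _ _ /IH.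
Qed.

Lemma subterm_subst (F : Type) (ar : F -> nat) (tau : nat -> term ar) s v pi :
  subterm_at s pi = Some v -> subterm_at (subst tau s) pi = Some (subst tau v).
Proof.
elim: pi s => [s|i pi IH [//|f ts]] /=; first by rewrite !subterm_nil => -[->].
by case: insubP => // j _ _ /IH.
Qed.

Lemma subterm_substV (F : Type) (ar : F -> nat) (tau : nat -> term ar) s u pi :
  subterm_at (subst tau s) pi = Some u ->
  (exists f vs, subterm_at s pi = Some (App f vs) /\ u = subst tau (App f vs)) \/
  exists x pi', subterm_at (tau x) pi' = Some u.
Proof.
elim: pi s => [|i pi IH] [x|f ts] //=; [by right; exists x, [::]| | |].
- by move=> [<-]; left; exists f, ts.
- by right; exists x, (i :: pi).
- by case: insubP => // j _ _ /IH.
Qed.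

Lemma replace_subst (F : Type) (ar : F -> nat) (tau : nat -> term ar) s v w pi :
  subterm_at s pi = Some v ->
  replace_at (subst tau s) pi (subst tau w) = subst tau (replace_at s pi w).
Proof.
elim: pi s => [s|i pi IH [//|f ts]] /=; first by rewrite !replace_nil.
case: insubP => // j _ ji /IH e.
congr App; apply/funext => l; case: eqP => // li.
by have -> : l = j by apply: val_inj; rewrite ji.
Qed.

Lemma subterm_arg (F : Type) (ar : F -> nat) f (ts : 'I_(ar f) -> term ar) j :
  subterm_at (App f ts) [:: val j] = Some (ts j).
Proof. by rewrite /= valK subterm_nil. Qed.

Lemma replace_arg (F : Type) (ar : F -> nat) f (ts : 'I_(ar f) -> term ar) j pi s :
  replace_at (App f ts) (val j :: pi) s = App f (upd ts j (replace_at (ts j) pi s)).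
Proof.
rewrite /=; congr App; apply/funext => i; rewrite /upd val_eqE.
by case: eqP => // ->.
Qed.

(** * Rewriting *)

Lemma nf_subterm (R : realType) (F : Type) (ar : F -> nat) (P : set (rule R ar))
    t u pi :
  normal_form (rewrite_step P) t -> subterm_at t pi = Some u ->
  normal_form (rewrite_step P) u.
Proof.
move=> nft tu [mu [r [sigma [pi' [Pr ur _]]]]]; apply: nft.
exists [seq (q.1, replace_at t (pi ++ pi') (subst sigma q.2)) | q <- rhs r].
by exists r, sigma, (pi ++ pi'); split=> //; rewrite (subterm_cat _ tu).
Qed.

Lemma redex_not_nf (R : realType) (F : Type) (ar : F -> nat) (P : set (rule R ar))
    r sigma :
  P r -> ~ normal_form (rewrite_step P) (subst sigma (lhs r)).
Proof.
move=> Pr; apply; eexists; exists r, sigma, [::].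
split; [exact: Pr|exact: subterm_nil|reflexivity].
Qed.

Lemma nf_Var (R : realType) (F : Type) (ar : F -> nat) (P : set (rule R ar)) x :
  is_PTRS P -> normal_form (rewrite_step P) (Var x).
Proof.
move=> [_ hP] [mu [r [sigma [[|i pi] [Pr //= e _]]]]].
by have [] := hP r Pr; case: (lhs r) e => [y _ /(_ y)|].
Qed.

Lemma innermost_stochastic (R : realType) (F : Type) (ar : F -> nat)
    (P : set (rule R ar)) :
  is_PTRS P -> stochastic (innermost_step P).
Proof.
move=> [_ hP] t mu [r [sigma [pi [/hP[_ [p0 p1] _] _ -> _]]]]; split.
  by move=> x /List.in_map_iff[q [<- /p0]].
by rewrite big_map.
Qed.

Lemma innermost_step_closed (R : realType) (F : Type) (ar : F -> nat)
    (P : set (rule R ar)) :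
  is_PTRS P -> step_closed (@terms_over F ar (signature P)) (innermost_step P).
Proof.
move=> [_ hP] t mu Dt [r [sigma [pi [Pr tpi -> _]]]] x.
move=> /List.in_map_iff[q [<- qr]] f /= fx.
have [/Dt //|] := syms_replace fx.
have [_ _ sub] := hP r Pr.
move=> fs; have [fq|[y /(sub q qr) yl fy]] := syms_subst fs.
  by exists r => //; right; exists q.
exact/Dt/(syms_subterm tpi)/(syms_subst_var yl).
Qed.

Lemma innermost_App (R : realType) (F : Type) (ar : F -> nat) (P : set (rule R ar))
    f (ts : 'I_(ar f) -> term ar) mu :
  innermost_step P (App f ts) mu ->
  (exists j nu, innermost_step P (ts j) nu /\
     mu = [seq (q.1, App f (upd ts j q.2)) | q <- nu]) \/
  (exists r sigma, P r /\ subst sigma (lhs r) = App f ts) /\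
  (forall j, normal_form (rewrite_step P) (ts j)).
Proof.
move=> [r [sigma [[|i pi] [Pr]]]].
  move=> [e] _ inn; right; split; first by exists r, sigma; rewrite -e.
  by move=> j; apply: inn; exists [:: val j]; split; rewrite -?e ?subterm_arg.
rewrite [subterm_at _ _]/=; case: insubP => // j _ <- tj -> inn; left.
exists j, [seq (q.1, replace_at (ts j) pi (subst sigma q.2)) | q <- rhs r].
split; first by exists r, sigma, pi.
by rewrite -map_comp; apply: eq_map => q /=; rewrite -replace_arg.
Qed.

(** [P] owns every rule of [Q] rooted in its signature, so terms over that signature are rewritten
    by [Q] with rules of [P] only. *)
Definition subsystem (R : realType) (F : Type) (ar : F -> nat)
    (P Q : set (rule R ar)) : Prop :=
  P `<=` Q /\
  forall r f ts, Q r -> lhs r = App f ts -> signature P f -> P r.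

Lemma subsystem_rule (R : realType) (F : Type) (ar : F -> nat)
    (P Q : set (rule R ar)) t pi sigma r :
  is_PTRS Q -> subsystem P Q -> terms_over (signature P) t -> Q r ->
  subterm_at t pi = Some (subst sigma (lhs r)) -> P r.
Proof.
move=> [_ hQ] [_ own] Dt Qr tpi; have [nV _ _] := hQ r Qr.
case E: (lhs r) => [x|f ts]; first by case: (nV x).
apply: (own _ _ _ Qr E); apply: Dt; apply: (syms_subterm tpi).
by rewrite E /=; left.
Qed.

Lemma subsystem_rewrite_nf (R : realType) (F : Type) (ar : F -> nat)
    (P Q : set (rule R ar)) t :
  is_PTRS Q -> subsystem P Q -> terms_over (signature P) t ->
  normal_form (rewrite_step P) t <-> normal_form (rewrite_step Q) t.
Proof.
move=> hQ PQ Dt; split=> nf [mu [r [sigma [pi [rin tpi mE]]]]]; apply: nf.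
  by exists mu, r, sigma, pi; split=> //; exact: (subsystem_rule hQ PQ Dt rin tpi).
by exists mu, r, sigma, pi; split=> //; apply: PQ.1.
Qed.

Lemma subsystem_innermost (R : realType) (F : Type) (ar : F -> nat)
    (P Q : set (rule R ar)) t mu :
  is_PTRS Q -> subsystem P Q -> terms_over (signature P) t ->
  innermost_step P t mu <-> innermost_step Q t mu.
Proof.
move=> hQ PQ Dt.
have nfE pi u s : subterm_at t pi = Some u -> proper_subterm s u ->
    normal_form (rewrite_step P) s <-> normal_form (rewrite_step Q) s.
  move=> tu [pi' [_ us]]; apply: subsystem_rewrite_nf => // f fs.
  exact/Dt/(syms_subterm tu)/(syms_subterm us).
split=> -[r [sigma [pi [rin tpi mE inn]]]]; exists r, sigma, pi; split=> //.
- exact: PQ.1.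
- by move=> s su; apply/(nfE _ _ _ tpi su)/inn.
- exact: (subsystem_rule hQ PQ Dt rin tpi).
- by move=> s su; apply/(nfE _ _ _ tpi su)/inn.
Qed.

Lemma AST_sub (R : realType) (A : Type) (D D' : set A)
    (to to' : A -> multidist R A -> Prop) :
  D `<=` D' -> (forall a mu, D a -> to a mu <-> to' a mu) ->
  AST D' to' -> AST D to.
Proof.
move=> DD' toE ast mu mufd mul.
have nfE a : D a -> normal_form to a <-> normal_form to' a.
  by move=> Da; split=> nf [nu /(toE _ _ Da) tonu]; apply: nf; exists nu.
have nfp : (fun n => nf_prob to (mu n)) = (fun n => nf_prob to' (mu n)).
  apply/funext => n; have [_] := mufd n; rewrite /nf_prob.
  elim: (mu n) => [|x nu IH] sup; first by rewrite !big_nil.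
  rewrite !big_cons IH; last by move=> y ?; apply: sup; right.
  by rewrite (asbool_equiv_eq (nfE _ (sup x (or_introl erefl)))).
rewrite nfp; apply: ast => n; first by have [? sup] := mufd n; split=> // x /sup/DD'.
have [_] := mufd n; elim: (mul n) => {mu mufd mul nfp n}.
- by move=> a nf sup; apply: lifting_nf; apply/nfE => //; apply: (sup (1, a)); left.
- by move=> a mu tomu sup; apply/lifting_step/toE => //; apply: (sup (1, a)); left.
- move=> n p mu nu p0 p1 _ IH sup; apply: lifting_convex => // j; apply: IH => x xj.
  apply: (sup (p j * x.1, x.2)); rewrite /mconvex.
  have : List.In j (enum 'I_n).
    have : j \in enum 'I_n by rewrite mem_enum.
    elim: (enum _) => //= i s IHs; rewrite inE => /orP[/eqP->|/IHs]; by [left|right].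
  elim: (enum _) => //= i s IHs [->|/IHs ?]; apply/List.in_app_iff; last by right.
  left; apply/List.in_map_iff; by exists x.
- move=> mu mu' nu nu' pm pn _ IH sup; apply: (lifting_perm pm pn); apply: IH.
  by move=> x xmu; apply: sup; apply: Permutation_in xmu.
Qed.

(** * Abstraction of foreign subterms *)

(** Variables are aliens too, so a substitution by aliens may also rename variables. *)
Definition alien (F : Type) (ar : F -> nat) (S : set F) (t : term ar) : Prop :=
  forall f ts, t = App f ts -> ~ S f.

Lemma subst_alien_inj (F : Type) (ar : F -> nat) (S : set F)
    (tau : nat -> term ar) s t :
  injective tau -> (forall x, alien S (tau x)) ->
  terms_over S s -> terms_over S t -> subst tau s = subst tau t -> s = t.
Proof.
move=> tau_inj al; elim: s t => [x|f ts IH] [y|g us] Ds Dt /= e.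
- by rewrite (tau_inj _ _ e).
- by case: (al x _ _ e); apply: Dt; left.
- by case: (al y _ _ (esym e)); apply: Ds; left.
- have fg : f = g by case: e.
  case: g / fg us Dt e => us Dt e; congr App; apply/funext => j.
  apply: IH; [by move=> h hj; apply: Ds; right; exists j| |].
    by move=> h hj; apply: Dt; right; exists j.
  exact: (congr1 (fun v => v j) (App_inj e)).
Qed.

(** A pattern over [S] cannot reach into an alien, whose root is not in [S]; the matched variables
    therefore start at or above the aliens. *)
Lemma subst_alien_match (F : Type) (ar : F -> nat) (S : set F)
    (tau sigma : nat -> term ar) l s :
  (forall x, alien S (tau x)) -> terms_over S l -> terms_over S s ->
  subst sigma l = subst tau s ->
  forall y, vars l y -> exists v, terms_over S v /\ sigma y = subst tau v.
Proof.
move=> al; elim: l s => [x|f ls IH] s Dl Ds /= e y.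
  by move=> ->; exists s.
move=> [j yj]; case: s Ds e => [x|g us] Ds /= e.
  by case: (al x _ _ (esym e)); apply: Dl; left.
have fg : f = g by case: e.
case: g / fg us Ds e => us Ds e; apply: (IH j (us j)) => //.
- by move=> h hj; apply: Dl; right; exists j.
- by move=> h hj; apply: Ds; right; exists j.
- exact: (congr1 (fun v => v j) (App_inj e)).
Qed.

(** A [Q]-step from [subst tau s] cannot lie inside a normal [tau x], so its redex sits at a
    function position of [s] and its rule belongs to [P]. Injectivity of [tau] makes non-linear
    matches survive the abstraction, so the step is the image of a [P]-step from [s]. *)
Lemma evasive_pullback (R : realType) (F : Type) (ar : F -> nat)
    (P Q : set (rule R ar)) (tau : nat -> term ar) U :
  is_PTRS Q -> subsystem P Q -> injective tau ->
  (forall x, alien (signature P) (tau x)) ->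
  (forall x, normal_form (rewrite_step Q) (tau x)) ->
  evasive setT (innermost_step Q) U ->
  evasive (terms_over (signature P)) (innermost_step P) (U \o subst tau).
Proof.
move=> hQ PQ tau_inj al tau_nf [U01 Uto]; split=> [s|s Ds Us e e0]; first exact: U01.
have [mu tomu Umu] := Uto _ I Us e e0.
have [r [sigma [pi [Qr spi muE inn]]]] := tomu.
have [[f [vs [spi' lE]]]|[x [pi' xpi]]] := subterm_substV spi; last first.
  by case: (redex_not_nf Qr (nf_subterm (tau_nf x) xpi)).
have Dv : terms_over (signature P) (App f vs).
  by move=> g gv; apply/Ds/(syms_subterm spi').
have [nV _ sub] := hQ.2 r Qr.
have Pr : P r.
  case E: (lhs r) lE => [y|g ts]; first by case: (nV y).
  by move=> /= [gf _]; apply: (PQ.2 _ _ _ Qr E); apply: Dv; left.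
have Dl : terms_over (signature P) (lhs r) by move=> g gl; exists r => //; left.
have /choice[sigma' sigmaP] (y : nat) : exists v, vars (lhs r) y ->
    terms_over (signature P) v /\ sigma y = subst tau v.
  have [yl|nyl] := pselect (vars (lhs r) y); last by exists (Var 0).
  by have [v vP] := subst_alien_match al Dl Dv lE yl; exists v.
have sigmaE t : vars t `<=` vars (lhs r) -> subst sigma t = subst tau (subst sigma' t).
  by move=> tl; rewrite subst_subst; apply: eq_subst => y /tl /sigmaP[].
have lE' : subst sigma' (lhs r) = App f vs.
  apply: (subst_alien_inj tau_inj al _ Dv); last by rewrite -lE sigmaE.
  by move=> g gs; have [/Dl//|[y /sigmaP[Dy _] /Dy]] := syms_subst gs.
exists [seq (q.1, replace_at s pi (subst sigma' q.2)) | q <- rhs r].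
  exists r, sigma', pi; split=> //; first by rewrite lE'.
  (* A redex in [w] would instantiate to one in a proper subterm of the original redex. *)
  move=> w [pi' [pi'0 wpi]] [nu [r' [rho [pi2 [Pr' wr' _]]]]].
  have wtau : proper_subterm (subst tau w) (subst sigma (lhs r)).
    exists pi'; split=> //; rewrite sigmaE //; exact: subterm_subst.
  have := inn _ wtau; apply; eexists; exists r', (fun y => subst tau (rho y)), pi2.
  split; [exact: PQ.1| |reflexivity].
  by rewrite -subst_subst; exact: subterm_subst.
rewrite (le_trans Umu) // lerD2r muE /expect !big_map le_eqVlt; apply/orP; left.
apply/eqP; elim: (rhs r) sub => [|q s' IH] sub; first by rewrite !big_nil.
rewrite !big_cons IH /=; last by move=> q' ?; apply: sub; right.
by rewrite (sigmaE _ (sub q (or_introl erefl))) (replace_subst _ _ spi').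
Qed.

HB.instance Definition _ (F : Type) (ar : F -> nat) := gen_eqMixin (term ar).

Fixpoint aliens (F : Type) (ar : F -> nat) (S : set F) (t : term ar)
    : seq (term ar) :=
  match t with
  | Var _ => [::]
  | App f ts => if `[< S f >] then flatten [seq aliens S (ts j) | j <- enum 'I_(ar f)]
                else [:: App f ts]
  end.

(** Indices below [size L] name aliens; the original variables are shifted past them. *)
Fixpoint abstract (F : Type) (ar : F -> nat) (S : set F) (L : seq (term ar))
    (t : term ar) : term ar :=
  match t with
  | Var x => Var (size L + x)
  | App f ts => if `[< S f >] then App f (fun j => abstract S L (ts j))
                else Var (index t L)
  end.

Definition concretize (F : Type) (ar : F -> nat) (L : seq (term ar)) (x : nat)
    : term ar :=
  if (x < size L)%N then nth (Var 0) L x else Var (x - size L).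

Lemma abstract_over (F : Type) (ar : F -> nat) (S : set F) L (t : term ar) :
  terms_over S (abstract S L t).
Proof.
elim: t => [x //|f ts IH] /=; case: asboolP => [Sf g /= [-> //|[j gj]]|_ g []].
exact: IH gj.
Qed.

Lemma abstractK (F : Type) (ar : F -> nat) (S : set F) L (t : term ar) :
  {subset aliens S t <= L} -> subst (concretize L) (abstract S L t) = t.
Proof.
elim: t => [x _|f ts IH] /=.
  by rewrite /concretize ltnNge leq_addr /= addKn.
case: asboolP => Sf tL /=.
  congr App; apply/funext => j; apply: IH => a aj; apply: tL.
  by apply/flatten_mapP; exists j => //; rewrite mem_enum.
have tin : App f ts \in L by apply: tL; rewrite inE.
by rewrite /concretize index_mem tin nth_index.
Qed.

Lemma aliens_subterm (F : Type) (ar : F -> nat) (S : set F) (t a : term ar) :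
  a \in aliens S t -> exists pi, subterm_at t pi = Some a.
Proof.
elim: t => [//|f ts IH] /=; case: asboolP => _; last first.
  by rewrite inE => /eqP->; exists [::].
move=> /flatten_mapP[j _ /IH[pi tpi]].
by exists (val j :: pi); rewrite /= valK.
Qed.

Lemma aliens_alien (F : Type) (ar : F -> nat) (S : set F) (t a : term ar) :
  a \in aliens S t -> exists f ts, a = App f ts /\ ~ S f.
Proof.
elim: t => [//|f ts IH] /=; case: asboolP => nSf; last first.
  by rewrite inE => /eqP->; exists f, ts.
by move=> /flatten_mapP[j _ /IH].
Qed.

Lemma abstraction (F : Type) (ar : F -> nat) (S : set F) (t : term ar) :
  exists s tau, [/\ t = subst tau s, terms_over S s, injective tau,
    forall x, alien S (tau x)
    & forall x, (exists y, tau x = Var y) \/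
        exists pi, subterm_at t pi = Some (tau x)].
Proof.
(* Without duplicates, [concretize L] is injective. *)
pose L := undup (aliens S t).
have nthL x : (x < size L)%N -> nth (Var 0) L x \in aliens S t.
  by move=> xL; rewrite -mem_undup mem_nth.
have al x : alien S (concretize L x).
  rewrite /concretize; case: ifP => [xL|_] f ts // E.
  have [g [us [E' nS]]] := aliens_alien (nthL _ xL).
  by move: E; rewrite E' => -[gf _]; rewrite -gf.
exists (abstract S L t), (concretize L); split=> //.
- by rewrite abstractK // => a; rewrite mem_undup.
- exact: abstract_over.
- move=> x y; rewrite /concretize.
  case: ifP => xL; case: ifP => yL.
  + by move=> /eqP; rewrite nth_uniq ?undup_uniq // => /eqP.
  + by have [g [us [-> _]]] := aliens_alien (nthL _ xL).
  + by have [g [us [-> _]]] := aliens_alien (nthL _ yL).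
  + move=> [e]; rewrite -(@subnKC (size L) x) ?e ?subnKC //.
      by rewrite leqNgt yL.
    by rewrite leqNgt xL.
- move=> x; rewrite /concretize; case: ifP => xL; last by left; exists (x - size L)%N.
  right; exact: aliens_subterm (nthL _ xL).
Qed.

(** * Modularity *)

(** As the root [f] belongs to [P], the aliens lie inside the arguments and are normal, which is
    what [evasive_pullback] requires. *)
Lemma innermost_call_doomed (R : realType) (F : Type) (ar : F -> nat)
    (P Q : set (rule R ar)) f (ts : 'I_(ar f) -> term ar) :
  is_PTRS P -> is_PTRS Q -> subsystem P Q -> innermost_AST P -> signature P f ->
  (forall j, normal_form (rewrite_step Q) (ts j)) ->
  doomed (innermost_step Q) (App f ts).
Proof.
move=> hP hQ PQ astP Sf nfts U evU.
have [s [tau [tE Ds tau_inj al tauP]]] := abstraction (signature P) (App f ts).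
have tau_nf x : normal_form (rewrite_step Q) (tau x).
  have [[y ->]|[[|i pi] tpi]] := tauP x; first exact: nf_Var.
    by case: (al x f ts) => //; case: tpi.
  move: tpi => /=; case: insubP => // j _ _; exact: nf_subterm (nfts j).
have ef : evasion_free (terms_over (signature P)) (innermost_step P).
  apply: AST_evasion_free => //; first exact: innermost_stochastic.
  exact: innermost_step_closed.
rewrite tE; exact: ef (evasive_pullback hQ PQ tau_inj al tau_nf evU) s Ds.
Qed.

Lemma innermost_evasion_free (R : realType) (F : Type) (ar : F -> nat)
    (Q : set (rule R ar)) :
  is_PTRS Q ->
  (forall f, defined_symbols Q f -> exists P,
    [/\ is_PTRS P, subsystem P Q, innermost_AST P & signature P f]) ->
  evasion_free setT (innermost_step Q).
Proof.
move=> hQ parts; have sto := innermost_stochastic hQ.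
suff all_doomed t : doomed (innermost_step Q) t by move=> U evU t _; apply: all_doomed.
elim: t => [x|f ts IH] U evU; have [U01 Uto] := evU.
  have /andP[U0 _] := U01 (Var x); apply/le_anti; rewrite U0 andbT leNgt.
  apply/negP => /(Uto _ I) /(_ 1 ltr01) [mu [r [sigma [pi [Qr xpi _ _]]]] _].
  by apply: (redex_not_nf Qr); apply: nf_subterm xpi; exact: nf_Var.
(* The components are the arguments, all of them mobile. A root step needs normal arguments, where
   [U] already vanishes, so only argument steps remain. *)
apply: (interleaving_evasion_free (k := ar f) (V := fun us => U (App f us)) sto
          (doomed_step_closed sto) (doomed_evasion_free sto)) => // us Dus Uus e e0.
have [mu tomu Umu] := Uto _ I Uus e e0.
have [[j [nu [tonu muE]]]|[[r [sigma [Qr lE]]] nfus]] := innermost_App tomu.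
  by exists j, nu; split=> //; move: Umu; rewrite muE (expect_map (fun b => App f (upd us j b))).
have [P [hP PQ astP Pf]] : exists P,
    [/\ is_PTRS P, subsystem P Q, innermost_AST P & signature P f].
  apply: parts; exists r => //; have [nV _ _] := hQ.2 r Qr.
  case: (lhs r) nV lE => [y /(_ y)//|g vs _ /= [gf _]]; rewrite -gf.
  by exists vs.
by move: Uus; rewrite (innermost_call_doomed hP hQ PQ astP Pf nfus evU) ltxx.
Qed.

Lemma defined_symbols_signature (R : realType) (F : Type) (ar : F -> nat)
    (P : set (rule R ar)) : defined_symbols P `<=` signature P.
Proof. by move=> f [r Pr [ts E]]; exists r => //; left; rewrite E; left. Qed.

(** A rule of [Q] rooted in the signature of [P] would make a shared symbol defined in [Q]. *)
Lemma subsystem_setUl (R : realType) (F : Type) (ar : F -> nat)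
    (P Q : set (rule R ar)) :
  signature P `&` signature Q `<=` constructors P `&` constructors Q ->
  subsystem P (P `|` Q).
Proof.
move=> hC; split=> [r Pr|r f ts [//|Qr] E Pf]; first by left.
have Qf : defined_symbols Q f by exists r => //; exists ts.
by have [_ [_ []]] := hC f (conj Pf (defined_symbols_signature Qf)).
Qed.

Lemma innermost_AST_subsystem (R : realType) (F : Type) (ar : F -> nat)
    (P Q : set (rule R ar)) :
  is_PTRS Q -> subsystem P Q -> innermost_AST Q -> innermost_AST P.
Proof.
move=> hQ PQ; apply: AST_sub => [t Dt f /Dt[r /PQ.1 Qr fr]|t mu Dt].
  by exists r.
exact: subsystem_innermost.
Qed.

Unset Implicit Arguments.

Theorem theorem7p13 (R : realType) (F : Type) (ar : F -> nat)
    (P1 P2 : set (rule R ar))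
    (hP1 : is_PTRS P1) (hP2 : is_PTRS P2)
    (hD : defined_symbols P1 `&` defined_symbols P2 = set0)
    (hC : signature P1 `&` signature P2 `<=` constructors P1 `&` constructors P2) :
  innermost_AST (P1 `|` P2) <-> innermost_AST P1 /\ innermost_AST P2.
Proof.
have hU : is_PTRS (P1 `|` P2).
  split.
    rewrite -bigcup2E; apply: bigcup_countable => // -[|[|i]] _ /=.
    - exact: hP1.1.
    - exact: hP2.1.
    - exact: countable0.
  by move=> r [/hP1.2|/hP2.2].
have s1 : subsystem P1 (P1 `|` P2) by apply: subsystem_setUl.
have s2 : subsystem P2 (P1 `|` P2).
  by rewrite setUC; apply: subsystem_setUl; rewrite setIC [X in _ `<=` X]setIC.
split=> [ast|[ast1 ast2]].
  by split; apply: innermost_AST_subsystem ast.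
apply: evasion_free_AST; first exact: innermost_stochastic.
apply: innermost_evasion_free => // f [r [Pr|Pr] [ts E]].
- exists P1; split=> //; apply: defined_symbols_signature; by exists r => //; exists ts.
- exists P2; split=> //; apply: defined_symbols_signature; by exists r => //; exists ts.
Qed.
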